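(* Let $(R,\mathfrak{m})$ be a commutative noetherian local ring with $\dim(R)\le1$. Then every separated flat $R$-module is totally separated.
   Context: An $R$-module $A$ is separated if $\bigcap_{n\ge1}\mathfrak{m}^nA=0$. An $R$-module $M$ is totally separated if $X\otimes_RM$ is separated for every finitely generated $R$-module $X$. *)

(* Defs.v *)
From HB Require Import structures.
From mathcomp Require Import all_boot all_order all_algebra.
From mathcomp Require Import boolp classical_sets.
From mathcomp Require Import freeg.

Set Implicit Arguments.
Unset Strict Implicit.
Unset Printing Implicit Defensive.

Import GRing.Theory.
Local Open Scope ring_scope.
Local Open Scope classical_set_scope.
Local Open Scope quotient_scope.

Section Submodules.
Variables (R : comNzRingType) (V : lmodType R).

Definition is_submodule (N : set V) : Prop := submod_closed [in N].

Definition submod_span (S : set V) : set V := smallest is_submodule S.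

Definition fin_gen_submodule (N : set V) : Prop :=
  exists s : seq V, N = submod_span [set` s].

Definition ideal_smul (I : set R) (N : set V) : set V :=
  submod_span [set a *: v | a in I & v in N].

End Submodules.

Definition fin_gen (R : comNzRingType) (X : lmodType R) : Prop :=
  fin_gen_submodule [set: X].

(* Ideals, the unit ideal included, are the submodules of the regular module
   R^o; mathcomp's [idealr_closed] describes the proper ideals only. *)
Definition is_ideal (R : comNzRingType) (I : set R) : Prop :=
  is_submodule (I : set R^o).

Definition noetherian (R : comNzRingType) : Prop :=
  forall I : set R, is_ideal I -> fin_gen_submodule (I : set R^o).

Definition is_proper_ideal (R : comNzRingType) (I : set R) : Prop :=
  idealr_closed [in I].

Definition is_prime_ideal (R : comNzRingType) (P : set R) : Prop :=
  is_proper_ideal P /\ prime_idealr_closed [in P].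

Definition is_maximal_ideal (R : comNzRingType) (I : set R) : Prop :=
  is_proper_ideal I /\ forall J : set R, is_proper_ideal J -> I `<=` J -> J = I.

Definition local_ring (R : comNzRingType) (m : set R) : Prop :=
  is_maximal_ideal m /\ forall n : set R, is_maximal_ideal n -> n = m.

(* A chain P_0 < ... < P_n of primes has length n. *)
Definition prime_chain (R : comNzRingType) (n : nat) (P : 'I_n.+1 -> set R) :
    Prop :=
  (forall i, is_prime_ideal (P i)) /\
  (forall i j : 'I_n.+1, (i < j)%N -> P i `<` P j).

(* dim R is the supremum of the lengths of the chains of primes of R. *)
Definition krull_dim_le (R : comNzRingType) (d : nat) : Prop :=
  forall (n : nat) (P : 'I_n.+1 -> set R), prime_chain P -> (n <= d)%N.

Definition ideal_pow (R : comNzRingType) (I : set R) (n : nat) : set R :=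
  iter n (fun J : set R => ideal_smul I (J : set R^o)) [set: R].

(* The tensor product A (x)_R B is the free R-module on A * B modulo the
   submodule spanned by the bilinearity relations. *)
Section Tensor.
Variables (R : comNzRingType) (A B : lmodType R).

Local Notation F := {freeg (A * B)%type / R}.
Local Notation gen a b := (<< (a, b) >> : F).

Definition tensor_relations : set F :=
  [set z | exists c a1 a2 b,
     z = gen (c *: a1 + a2) b - (c *: gen a1 b + gen a2 b)] `|`
  [set z | exists c a b1 b2,
     z = gen a (c *: b1 + b2) - (c *: gen a b1 + gen a b2)].

Definition tensor_null : {pred F} := [in submod_span tensor_relations].

Lemma submod_span_submodule (V : lmodType R) (S : set V) : is_submodule (submod_span S).
Proof.
split=> [|c u v]; rewrite !inE.
  by move=> N [[]]; rewrite inE.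
move=> uS vS N SN; have uN := uS _ SN; have vN := vS _ SN.
by apply: set_mem; apply: SN.1.2; rewrite inE.
Qed.

Lemma tensor_null_submod_closed : submod_closed tensor_null.
Proof. exact: (submod_span_submodule tensor_relations). Qed.

HB.instance Definition _ :=
  GRing.isSubmodClosed.Build R F tensor_null tensor_null_submod_closed.

Definition tensor : Type := @Quotient.quot F tensor_null.

HB.instance Definition _ := GRing.Zmodule.on tensor.

Definition tensor_pi (z : F) : tensor := \pi_(Quotient.quot tensor_null) z.

Lemma tensor_piP z1 z2 :
  tensor_pi z1 = tensor_pi z2 <-> z1 - z2 \in tensor_null.
Proof. by rewrite (Quotient.idealrBE tensor_null); split=> [|/eqP] // /eqP. Qed.

Lemma tensor_pi_surj (t : tensor) : exists z, t = tensor_pi z.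
Proof.
by exists (repr (t : Quotient.quot tensor_null)); rewrite /tensor_pi reprK.
Qed.

Lemma tensor_piD : {morph tensor_pi : z1 z2 / z1 + z2}.
Proof. by move=> z1 z2; rewrite /tensor_pi piE. Qed.

Definition tensor_scale (c : R) (t : tensor) : tensor :=
  tensor_pi (c *: repr (t : Quotient.quot tensor_null)).

Lemma tensor_scale_pi c z : tensor_scale c (tensor_pi z) = tensor_pi (c *: z).
Proof.
apply/tensor_piP; rewrite -scalerBr rpredZ //.
by apply/tensor_piP; rewrite /tensor_pi reprK.
Qed.

Lemma tensor_scaleA c d t :
  tensor_scale c (tensor_scale d t) = tensor_scale (c * d) t.
Proof.
by have [z ->] := tensor_pi_surj t; rewrite !tensor_scale_pi scalerA.
Qed.

Lemma tensor_scale1 : left_id 1 tensor_scale.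
Proof.
by move=> t; have [z ->] := tensor_pi_surj t; rewrite tensor_scale_pi scale1r.
Qed.

Lemma tensor_scaleDr : right_distributive tensor_scale +%R.
Proof.
move=> c t u; have [[z ->] [w ->]] := (tensor_pi_surj t, tensor_pi_surj u).
by rewrite -tensor_piD !tensor_scale_pi -tensor_piD scalerDr.
Qed.

Lemma tensor_scaleDl t : {morph tensor_scale^~ t : c d / c + d}.
Proof.
move=> c d; have [z ->] := tensor_pi_surj t.
by rewrite !tensor_scale_pi -tensor_piD scalerDl.
Qed.

HB.instance Definition _ := GRing.Zmodule_isLmodule.Build R tensor
  tensor_scaleA tensor_scale1 tensor_scaleDr tensor_scaleDl.

Lemma tensor_pi_linear : linear tensor_pi.
Proof.
move=> c z w; rewrite tensor_piD; congr (_ + _).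
exact/esym/tensor_scale_pi.
Qed.

HB.instance Definition _ := GRing.isLinear.Build R F tensor *:%R tensor_pi
  tensor_pi_linear.

Definition tens (a : A) (b : B) : tensor := tensor_pi (gen a b).

Lemma tens_bilinear : bilinear_for *:%R *:%R tens.
Proof.
split=> [b c a1 a2|a c b1 b2] /=; rewrite /tens -linearP /=; apply/tensor_piP;
  rewrite inE; apply: sub_gen_smallest.
- by left; exists c, a1, a2, b.
- by right; exists c, a, b1, b2.
Qed.

HB.instance Definition _ := bilinear_isBilinear.Build R A B tensor *:%R *:%R
  tens tens_bilinear.

Section Lift.
Variables (W : lmodType R) (f : {bilinear A -> B -> W}).

Let f' (ab : A * B) : W := f ab.1 ab.2.

Lemma fglift_linear : linear (fglift f' : F -> W).
Proof.
have liftD := lift_is_additive f'.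
have lift0 : fglift f' 0 = 0 by rewrite -(subrr 0) liftD subrr.
have liftDD (x y : F) : fglift f' (x + y) = fglift f' x + fglift f' y.
  by rewrite -{1}[y]opprK -[- y]sub0r !liftD lift0 sub0r opprK.
move=> c z w; rewrite liftDD; congr (_ + _).
have lift_sum (s : seq (A * B)) (k : A * B -> R) :
    fglift f' (\sum_(x <- s) << k x *g x >>) = \sum_(x <- s) k x *: f' x.
  elim: s => [|x s IHs]; first by rewrite !big_nil.
  by rewrite !big_cons liftDD IHs liftU.
rewrite -{2}(freeg_sumE z) [c *: z]/(fgscale c z) /fgscale !lift_sum scaler_sumr.
by apply: eq_bigr => x _; rewrite scalerA.
Qed.

Definition tensor_lift (t : tensor) : W :=
  fglift f' (repr (t : Quotient.quot tensor_null)).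

Lemma tensor_lift_pi z : tensor_lift (tensor_pi z) = fglift f' z.
Proof.
have [g gE] : exists g : {linear F -> W}, g =1 fglift f'.
  by exists (HB.pack_for {linear F -> W} (fglift f' : F -> W)
    (GRing.isLinear.Build R F W *:%R (fglift f') fglift_linear)).
have gU a b : g (gen a b) = f a b by rewrite gE liftU scale1r.
have Nker : submod_span tensor_relations `<=` [set x | g x = 0].
  apply: smallest_sub => [|x].
    split=> [|c u v]; rewrite !inE /= ?linear0 // => gu gv.
    by rewrite linearP gu gv scaler0 addr0.
  by case=> -[c [a [b [d ->]]]]; rewrite /mkset linearB linearP !gU
    ?linearPl ?linearPr /= subrr.
have /tensor_piP : tensor_pi (repr (tensor_pi z : Quotient.quot tensor_null)) =
    tensor_pi z by rewrite /tensor_pi reprK.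
by rewrite inE => /Nker; rewrite /mkset linearB !gE => /subr0_eq.
Qed.

Lemma tensor_lift_linear : linear tensor_lift.
Proof.
move=> c t u; have [[z ->] [w ->]] := (tensor_pi_surj t, tensor_pi_surj u).
by rewrite -linearP !tensor_lift_pi fglift_linear.
Qed.

HB.instance Definition _ := GRing.isLinear.Build R tensor W *:%R tensor_lift
  tensor_lift_linear.

Lemma tensor_lift_tens a b : tensor_lift (tens a b) = f a b.
Proof. by rewrite tensor_lift_pi liftU scale1r. Qed.

End Lift.

Lemma tensor_ext (W : lmodType R) (g h : {linear tensor -> W}) :
  (forall a b, g (tens a b) = h (tens a b)) -> g =1 h.
Proof.
move=> gh t; have [z ->] := tensor_pi_surj t.
rewrite -(freeg_sumE z) !linear_sum; apply: eq_bigr => -[a b] _.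
have -> : << coeff (a, b) z *g (a, b) >> = coeff (a, b) z *: gen a b.
  by apply/eqP/freeg_eqP => k; rewrite coeffZ !coeffU mul1r.
by rewrite !linearZ; congr (_ *: _); apply: gh.
Qed.

End Tensor.

Section TensorMap.
Variables (R : comNzRingType) (A B A' B' : lmodType R).
Variables (f : {linear A -> A'}) (g : {linear B -> B'}).

Definition tens_comp (a : A) (b : B) : tensor A' B' := tens (f a) (g b).

Lemma tens_comp_bilinear : bilinear_for *:%R *:%R tens_comp.
Proof.
by split=> [b c a1 a2|a c b1 b2]; rewrite /tens_comp linearP (linearPl, linearPr).
Qed.

HB.instance Definition _ := bilinear_isBilinear.Build R A B (tensor A' B')
  *:%R *:%R tens_comp tens_comp_bilinear.

Definition tensor_map : tensor A B -> tensor A' B' := tensor_lift tens_comp.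

HB.instance Definition _ := GRing.Linear.on tensor_map.

Lemma tensor_map_tens a b : tensor_map (tens a b) = tens (f a) (g b).
Proof. exact: tensor_lift_tens. Qed.

End TensorMap.

Definition exact (R : comNzRingType) (A B C : lmodType R)
    (f : {linear A -> B}) (g : {linear B -> C}) : Prop :=
  range f = [set b | g b = 0].

Definition flat (R : comNzRingType) (M : lmodType R) : Prop :=
  forall (A B C : lmodType R) (f : {linear A -> B}) (g : {linear B -> C}),
    exact f g ->
    exact (tensor_map f (idfun : {linear M -> M}))
          (tensor_map g (idfun : {linear M -> M})).

Definition separated (R : comNzRingType) (m : set R) (A : lmodType R) : Prop :=
  \bigcap_(n in [set n | (1 <= n)%N]) ideal_smul (ideal_pow m n) [set: A] =
  [set 0].

Definition totally_separated (R : comNzRingType) (m : set R) (M : lmodType R) :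
    Prop :=
  forall X : lmodType R, fin_gen X -> separated m (tensor X M).

(* Main.v *)
Require Import Defs.
From HB Require Import structures.
From mathcomp Require Import all_boot all_order all_algebra.
From mathcomp Require Import boolp classical_sets freeg.

Set Implicit Arguments.
Unset Strict Implicit.
Unset Printing Implicit Defensive.

(** For a submodule N of X, write N M for the image of N (x) M in X (x) M. The
    proof shows that N M is closed in X (x) M, in the sense that it contains
    every t lying in (m^n X + N) M for all n; for N = 0 this is the separation
    of X (x) M. The argument is a noetherian induction on N
    ([tensor_sub_closed]). If N is not X, some x has a prime colon ideal
    p = (N : x), and N' = N + R x satisfies the claim, so that t is in N' M.
    Two facts then control t.

    Flatness makes N |-> N M commute with preimages, hence with intersections
    ([flat_preimage]). With the Artin-Rees lemma ([artin_rees]) it puts t in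
    (N + m^k x) M for every k, and, t being x (x) y modulo N M, it puts y in
    (m^k + p) M for every k.

    As dim R <= 1, either p = m or p is a minimal prime. If p = m, then m x is
    already contained in N. A minimal prime of a noetherian ring is the
    annihilator of some z in R ([nonmaximal_prime_annihilator]); then z y lies
    in m^k M for every k, so z y = 0 because M is separated, and flatness gives
    y in p M, that is, x (x) y in N M. *)

Import GRing.Theory.
Local Open Scope ring_scope.
Local Open Scope classical_set_scope.

(** * Submodules and noetherian modules *)

Section SubmoduleTheory.
Variable R : comNzRingType.
Implicit Types V W : lmodType R.

Lemma submoduleP V (N : set V) :
  is_submodule N <-> N 0 /\ forall c u v, N u -> N v -> N (c *: u + v).
Proof.
split=> [[N0 NL]|[N0 NL]]; split=> [|c u v].
- exact: set_mem N0.
- by move=> Nu Nv; apply: set_mem; apply: NL; rewrite inE.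
- by rewrite inE.
- by rewrite !inE; apply: NL.
Qed.

Lemma submodule0 V (N : set V) : is_submodule N -> N 0.
Proof. by case/submoduleP. Qed.

Lemma submoduleZ V (N : set V) c u : is_submodule N -> N u -> N (c *: u).
Proof. by case/submoduleP=> N0 NL Nu; rewrite -[c *: u]addr0; apply: NL. Qed.

Lemma submoduleD V (N : set V) u v : is_submodule N -> N u -> N v -> N (u + v).
Proof. by case/submoduleP=> N0 NL Nu Nv; rewrite -[u]scale1r; apply: NL. Qed.

Lemma submoduleB V (N : set V) u v : is_submodule N -> N u -> N v -> N (u - v).
Proof.
by move=> sN Nu Nv; rewrite -scaleN1r; apply: submoduleD => //;
  apply: submoduleZ.
Qed.

Lemma submoduleM (I : set R) a b : is_ideal I -> I b -> I (a * b).
Proof. by move=> sI; apply: (@submoduleZ R^o I a b). Qed.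

Lemma submodule_setT V : is_submodule [set: V].
Proof. exact/submoduleP. Qed.

Lemma submodule_set1 V : is_submodule [set 0 : V].
Proof. by apply/submoduleP; split=> // c u v -> ->; rewrite scaler0 addr0. Qed.

Lemma submodule_setI V (N N' : set V) :
  is_submodule N -> is_submodule N' -> is_submodule (N `&` N').
Proof.
move=> /submoduleP[N0 NL] /submoduleP[N'0 N'L]; apply/submoduleP; split=> //.
by move=> c u v [Nu N'u] [Nv N'v]; split; [apply: NL|apply: N'L].
Qed.

Lemma submodule_preimage V W (f : {linear V -> W}) (N : set W) :
  is_submodule N -> is_submodule (f @^-1` N).
Proof.
move=> /submoduleP[N0 NL]; apply/submoduleP; split=> [|c u v Nu Nv].
  by rewrite /preimage /= linear0.
by rewrite /preimage /= linearP; apply: NL.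
Qed.

Lemma submodule_image V W (f : {linear V -> W}) (N : set V) :
  is_submodule N -> is_submodule (f @` N).
Proof.
move=> /submoduleP[N0 NL]; apply/submoduleP; split.
  by exists 0 => //; rewrite linear0.
move=> c _ _ [u Nu <-] [v Nv <-].
by exists (c *: u + v); [apply: NL|rewrite linearP].
Qed.

Definition submodule_sum V (N N' : set V) : set V :=
  [set u + v | u in N & v in N'].

Lemma submodule_sumP V (N N' : set V) :
  is_submodule N -> is_submodule N' -> is_submodule (submodule_sum N N').
Proof.
move=> /submoduleP[N0 NL] /submoduleP[N'0 N'L]; apply/submoduleP; split.
  by exists 0 => //; exists 0 => //; rewrite addr0.
move=> c _ _ [u Nu [u' N'u <-]] [v Nv [v' N'v <-]].
exists (c *: u + v); first exact: NL.
by exists (c *: u' + v'); [apply: N'L|rewrite scalerDr addrACA].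
Qed.

Lemma sub_submodule_suml V (N N' : set V) :
  is_submodule N' -> N `<=` submodule_sum N N'.
Proof.
by move=> /submodule0 N'0 u Nu; exists u => //; exists 0; rewrite ?addr0.
Qed.

Lemma sub_submodule_sumr V (N N' : set V) :
  is_submodule N -> N' `<=` submodule_sum N N'.
Proof.
by move=> /submodule0 N0 u Nu; exists 0 => //; exists u; rewrite ?add0r.
Qed.

Lemma submod_span_sub V (S N : set V) :
  is_submodule N -> S `<=` N -> submod_span S `<=` N.
Proof. exact: smallest_sub. Qed.

Lemma sub_submod_span V (S : set V) : S `<=` submod_span S.
Proof. exact: sub_gen_smallest. Qed.

Lemma submod_span_mono V (S S' : set V) :
  S `<=` S' -> submod_span S `<=` submod_span S'.
Proof.
move=> SS'; apply: submod_span_sub; first exact: submod_span_submodule.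
by move=> u /SS'; apply: sub_submod_span.
Qed.

(** The homomorphism R -> V sending 1 to x; its preimages are the colon ideals
    (N : x), and its images of ideals are the submodules I x. *)
Definition smul V (x : V) (a : R^o) : V := a *: x.

Lemma smul_linear V (x : V) : linear (smul x).
Proof. by move=> c a b; rewrite /smul scalerDl scalerA. Qed.

HB.instance Definition _ V (x : V) :=
  GRing.isLinear.Build R R^o V *:%R (smul x) (smul_linear x).

Definition colon V (N : set V) (x : V) : set R := smul x @^-1` N.

Lemma colon_ideal V (N : set V) x : is_submodule N -> is_ideal (colon N x).
Proof. exact: submodule_preimage. Qed.

Definition noetherian_module V : Prop :=
  forall N : set V, is_submodule N -> fin_gen_submodule N.

(** If N lies in the span of x :: s, then N is generated by the part of N in the
    span of s together with lifts to N of generators of the ideal of the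
    coefficients that x takes on N. *)
Lemma fin_gen_noetherian V :
  noetherian R -> fin_gen V -> noetherian_module V.
Proof.
move=> Rnoeth [s sV] N sN; have : N `<=` submod_span [set` s] by rewrite -sV.
elim: s N sN {sV} => [|x s IHs] N sN Ns.
  by exists [::]; apply/seteqP; split=> //; apply: submod_span_sub.
have ss := submod_span_submodule [set` s].
have sJ := submodule_preimage (smul x) (submodule_sumP sN ss).
have [rs Jrs] := Rnoeth _ sJ.
have [g gP] : exists g : R -> V, forall r, r \in rs ->
    N (g r) /\ submod_span [set` s] (r *: x - g r).
  have gex r : exists v, r \in rs -> N v /\ submod_span [set` s] (r *: x - v).
    have [rrs|_] := boolP (r \in rs); last by exists 0.
    have /= : (smul x @^-1` submodule_sum N (submod_span [set` s])) r.
      by rewrite Jrs; apply: sub_submod_span.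
    case=> u Nu [v sv uvE]; exists u => _.
    by split; rewrite // -[_ *: _]uvE addrC addKr.
  by have [g gP] := choice gex; exists g.
have [s2 Ns2] := IHs _ (submodule_setI sN ss) (@subIsetr _ _ _).
exists (map g rs ++ s2); apply/seteqP; split; last first.
  apply: submod_span_sub => // v /=.
  rewrite mem_cat => /orP[/mapP[r rrs ->]|vs2].
    by case: (gP r rrs).
  have : submod_span [set` s2] v by apply: sub_submod_span.
  by rewrite -Ns2 => -[].
have s1 := submod_span_submodule [set` map g rs].
have sx := submodule_sumP (submodule_image (smul x) (submodule_setT R^o)) ss.
move=> v Nv.
have [_ [r _ <-] [w sw vE]] :
    submodule_sum (range (smul x)) (submod_span [set` s]) v.
  apply: submod_span_sub (Ns _ Nv) => // u /=; rewrite inE => /orP[/eqP->|us].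
    apply: sub_submodule_suml => //; exists 1 => //; exact: scale1r.
  apply: sub_submodule_sumr.
    exact: submodule_image (submodule_setT R^o).
  exact: sub_submod_span.
have Jr : (smul x @^-1` submodule_sum N (submod_span [set` s])) r.
  exists v => //; exists (- w); rewrite -?vE ?addrK // -sub0r.
  exact: submoduleB ss (submodule0 ss) sw.
have : (smul x @^-1`
    submodule_sum (submod_span [set` map g rs]) (submod_span [set` s])) r.
  move: r Jr {vE}; rewrite Jrs; apply: submod_span_sub.
    exact: submodule_preimage (submodule_sumP s1 ss).
  move=> r rrs; have [_ sr] := gP r rrs; exists (g r).
    by apply: sub_submod_span; apply: map_f.
  by exists (r *: x - g r); rewrite // addrC subrK.
case=> n sn [w' sw' rE].
have vE' : v = n + (w' + w) by rewrite -vE -rE addrA.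
have Nn : N n.
  apply: submod_span_sub sn => // u /= /mapP[r' rrs ->]; by case: (gP r' rrs).
have N2 : (N `&` submod_span [set` s]) (w' + w).
  split; last exact: submoduleD ss sw' sw.
  by rewrite -[w' + w](addKr n) -vE' addrC; apply: submoduleB sN Nv Nn.
rewrite vE'; apply: (submoduleD (submod_span_submodule _)).
  by apply: submod_span_mono sn => u /= us; rewrite mem_cat us.
move: N2; rewrite Ns2; apply: submod_span_mono => u /= us.
by rewrite mem_cat us orbT.
Qed.

(** Noetherian induction: a maximal counterexample exists by Zorn's lemma, since
    finite generation puts the union of a chain of submodules into the chain.
    Adjoining N0 to the members keeps the empty chain from being special. *)
Lemma noetherian_ind V (P : set V -> Prop) :
    noetherian_module V ->
    (forall N, is_submodule N ->
      (forall N', is_submodule N' -> N `<` N' -> P N') -> P N) ->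
  forall N, is_submodule N -> P N.
Proof.
move=> Vnoeth PI N0 sN0; apply: contrapT => nPN0.
pose Q (A : set V) := is_submodule (A `|` N0) /\ ~ P (A `|` N0).
have [F FQ Ftot|A [[sA nPA] Amax]] := @Zorn_bigcup V Q; last first.
  apply: nPA; apply: PI => // N' sN' [AN' nN'A]; apply: contrapT => nPN'.
  have N'E : N' `|` N0 = N'.
    by apply/setUidPl => u uN0; apply: AN'; right.
  apply: (Amax N'); last by rewrite /Q N'E.
  by split=> [u Au|N'A]; [apply: AN'; left|apply: nN'A => u /N'A; left].
have [[A0 FA0]|F0] := pselect (exists A, F A); last first.
  have -> : \bigcup_(X in F) X = set0.
    by rewrite -subset0 => u [A FA]; case: F0; exists A.
  by rewrite /Q set0U.
rewrite /Q; set U := _ `|` N0.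
have Uin (s : seq V) : {in s, forall u, U u} ->
    exists2 A, F A & {in s, forall u, (A `|` N0) u}.
  elim: s => [|u s IHs] sU; first by exists A0.
  have [|A FA sA] := IHs; first by move=> v vs; apply: sU; rewrite inE vs orbT.
  have /sU[[B FB Bu]|N0u] : u \in u :: s by rewrite mem_head.
    case: (Ftot _ _ FA FB) => AB.
      exists B => // v; rewrite inE => /orP[/eqP->|/sA[/AB|]];
        by [left|left|right].
    by exists A => // v; rewrite inE => /orP[/eqP->|/sA//]; left; apply: AB.
  by exists A => // v; rewrite inE => /orP[/eqP->|/sA//]; right.
have sU : is_submodule U.
  apply/submoduleP; split=> [|c u v Uu Uv]; first by right; apply: submodule0.
  have [|A FA sA] := Uin [:: u; v].
    by move=> w; rewrite !inE => /orP[]/eqP->.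
  have [sAN _] := FQ _ FA.
  have [Acuv|] : (A `|` N0) (c *: u + v); [|by left; exists A|by right].
  apply: (submoduleD sAN); first apply: (submoduleZ _ sAN).
    by apply: sA; rewrite mem_head.
  by apply: sA; rewrite !inE eqxx orbT.
have [s UE] := Vnoeth _ sU.
have [|A FA sA] := Uin s.
  by move=> u us; rewrite UE; apply: sub_submod_span.
have [sAN nPAN] := FQ _ FA.
suff UA : U = A `|` N0 by split; rewrite -/U UA.
apply/seteqP; split; first by rewrite UE; apply: submod_span_sub.
by move=> u [Au|N0u]; [left; exists A|right].
Qed.

End SubmoduleTheory.

(** * Powers of an ideal and the Artin-Rees lemma *)

Section ArtinRees.
Variable (R : comNzRingType) (m : set R).

Lemma ideal_powP n : is_ideal (ideal_pow m n).
Proof.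
by case: n => [|n]; [exact: (@submodule_setT R R^o)|exact: submod_span_submodule].
Qed.

Lemma ideal_pow_mul n a b :
  m a -> ideal_pow m n b -> ideal_pow m n.+1 (a * b).
Proof. by move=> ma mb; apply: sub_submod_span; exists a => //; exists b. Qed.

Lemma ideal_pow_sub n (J : set R) :
    is_ideal J -> (forall a b, m a -> ideal_pow m n b -> J (a * b)) ->
  ideal_pow m n.+1 `<=` J.
Proof.
move=> sJ mJ; apply: (@submod_span_sub R R^o _ _ sJ) => _ [a ma [b mb <-]].
exact: mJ.
Qed.

Lemma ideal_pow_exp n a : m a -> ideal_pow m n (a ^+ n).
Proof.
by move=> ma; elim: n => // n IHn; rewrite exprS; apply: ideal_pow_mul.
Qed.

Lemma ideal_pow_add n1 n2 (J : set R) :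
    is_ideal J ->
    (forall a b, ideal_pow m n1 a -> ideal_pow m n2 b -> J (a * b)) ->
  ideal_pow m (n1 + n2) `<=` J.
Proof.
elim: n1 J => [|n1 IHn1] J sJ mJ.
  by move=> a ma; rewrite -[a]mul1r; apply: mJ.
rewrite addSn; apply: ideal_pow_sub => // a b ma mb.
apply: (IHn1 (( *:%R a : R^o -> R^o) @^-1` J) _ _ b mb).
  exact: (@submodule_preimage R R^o R^o ( *:%R a)).
move=> c d mc md; rewrite /preimage /= -[_ *: _]/(a * (c * d)) mulrA.
by apply: mJ => //; apply: ideal_pow_mul.
Qed.

Variables (V : lmodType R) (Vnoeth : noetherian_module V).

(** By noetherian induction on Y: if a x is outside Y for some a in m, both the
    submodules (Y : a) and Y + a V are strictly larger than Y, and
    a (Y : a) <= Y makes exponents for these two add up to one for Y. *)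
Lemma nilpotent_pow (Y : set V) :
    is_submodule Y -> (forall a v, m a -> exists i, Y (a ^+ i *: v)) ->
  exists n, forall a v, ideal_pow m n a -> Y (a *: v).
Proof.
move: Y; apply: (noetherian_ind Vnoeth) => Y sY IH Ynil.
have [mY|] := pselect (forall a v, m a -> Y (a *: v)).
  exists 1 => a v; apply: (@ideal_pow_sub 0 (colon Y v)); first exact: colon_ideal.
  move=> {}a b ma _; rewrite /colon /preimage /= /smul mulrC -scalerA.
  exact: submoduleZ (mY _ _ ma).
move=> /existsNP[a /existsNP[x /not_implyP[ma nYax]]].
have [y nYy Yay] : exists2 y, ~ Y y & Y (a *: y).
  have [i Yi] := Ynil a x ma; elim: i Yi => [|i IHi] Yi.
    by case: nYax; apply: submoduleZ => //; rewrite expr0 scale1r in Yi.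
  have [/IHi//|nYi] := pselect (Y (a ^+ i *: x)).
  by exists (a ^+ i *: x); rewrite // scalerA -exprS.
have sY1 := @submodule_preimage _ _ _ ( *:%R a : {linear V -> V}) _ sY.
have sa := submodule_image ( *:%R a : {linear V -> V}) (submodule_setT V).
have sY2 := submodule_sumP sY sa.
have Y1 : Y `<=` ( *:%R a : V -> V) @^-1` Y by move=> v; apply: submoduleZ.
have Y2 := @sub_submodule_suml _ _ Y _ sa.
have [||n1 n1P] := IH _ sY1.
- by split=> // /(_ y Yay).
- by move=> b v mb; have [i /Y1] := Ynil b v mb; exists i.
have [||n2 n2P] := IH _ sY2.
- split=> // /(_ (a *: x)) Yax; apply: nYax; apply: Yax.
  by apply: sub_submodule_sumr => //; exists x.
- by move=> b v mb; have [i /Y2] := Ynil b v mb; exists i.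
exists (n1 + n2)%N => c v; apply: (@ideal_pow_add n1 n2 (colon Y v)).
  exact: colon_ideal.
move=> b d mb md; rewrite /colon /preimage /= /smul -scalerA.
have [u Yu [_ [w _ <-] <-]] := n2P _ v md; rewrite scalerDr.
apply: submoduleD => //; first exact: submoduleZ.
by rewrite scalerA mulrC -scalerA; apply: n1P.
Qed.

(** A topological form of the Artin-Rees lemma, by noetherian induction on Y.
    If a in m is not nilpotent on V / Y, let U be the submodule of the vectors
    that a power of a takes into Y; one power a^i takes all of U into Y. Then
    Y + a^i V is strictly larger than Y, but has the same intersection with N
    up to Y: if y + a^i x is in N, then x is in U. *)
Lemma artin_rees (N Y : set V) :
    is_submodule N -> is_submodule Y ->
    (forall a v, m a -> N v -> exists i, Y (a ^+ i *: v)) ->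
  exists n, ideal_smul (ideal_pow m n) [set: V] `&` N `<=` Y.
Proof.
move=> sN; move: Y; apply: (noetherian_ind Vnoeth) => Y sY IH Ynil.
have [/(nilpotent_pow sY)[n nP]|] :=
    pselect (forall a v, m a -> exists i, Y (a ^+ i *: v)).
  exists n => w [+ _]; apply: submod_span_sub => // _ [a ma [v _ <-]]; exact: nP.
move=> /existsNP[a /existsNP[x /not_implyP[ma /forallNP nYax]]].
pose U : set V := [set v | exists i, Y (a ^+ i *: v)].
have Uinc v i j : Y (a ^+ i *: v) -> Y (a ^+ (j + i) *: v).
  by move=> Yi; rewrite exprD -scalerA; apply: submoduleZ.
have sU : is_submodule U.
  apply/submoduleP; split=> [|c u v [i Yi] [j Yj]].
    by exists 0; rewrite scaler0; apply: submodule0.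
  exists (i + j)%N; rewrite scalerDr; apply: submoduleD => //; last exact: Uinc.
  rewrite scalerA mulrC -scalerA; apply: submoduleZ => //.
  by rewrite addnC; apply: Uinc.
have [i iP] : exists i, forall v, U v -> Y (a ^+ i *: v).
  have [s UE] := Vnoeth sU.
  have sU' : {in s, forall v, U v}.
    by move=> v vs; rewrite UE; apply: sub_submod_span.
  have [i iP] : exists i, {in s, forall v, Y (a ^+ i *: v)}.
    elim: s sU' {UE} => [|u s IHs] sU'; first by exists 0.
    have [|i iP] := IHs; first by move=> v vs; apply: sU'; rewrite inE vs orbT.
    have /sU'[j Yj] : u \in u :: s by rewrite mem_head.
    exists (i + j)%N => v; rewrite inE => /orP[/eqP->|/iP]; first exact: Uinc.
    by rewrite addnC; apply: Uinc.
  exists i => v; rewrite UE.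
  by apply: (submod_span_sub
    (submodule_preimage ( *:%R (a ^+ i) : {linear V -> V}) sY)).
have sa := submodule_image ( *:%R (a ^+ i) : {linear V -> V}) (submodule_setT V).
have sY2 := submodule_sumP sY sa.
have Y2 := @sub_submodule_suml _ _ Y _ sa.
have [||n nP] := IH _ sY2.
- split=> // /(_ (a ^+ i *: x)) Yx; apply: (nYax i); apply: Yx.
  by apply: sub_submodule_sumr => //; exists x.
- by move=> b v mb Nv; have [j /Y2] := Ynil b v mb Nv; exists j.
exists n => w wn; have [_ Nw] := wn.
have [y Yy [_ [v _ <-] wE]] := nP w wn.
rewrite -wE; apply: submoduleD => //; apply: iP.
have [j Yj] := Ynil _ _ ma Nw; exists (j + i)%N.
rewrite exprD -scalerA -[a ^+ i *: v](addKr y) wE addrC scalerBr.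
by apply: submoduleB => //; apply: submoduleZ.
Qed.

End ArtinRees.

(** * Associated and minimal primes *)

Section Primes.
Variables (R : comNzRingType) (Rnoeth : noetherian R).

Lemma proper_idealP (P : set R) : is_proper_ideal P <-> is_ideal P /\ ~ P 1.
Proof.
split=> [[P0 P1 PL]|[/submoduleP[P0 PL] P1]].
  by split=> // P1'; move/negP: P1; apply; rewrite inE.
split; rewrite ?inE //; first by apply/negP; rewrite inE.
by move=> a u v; rewrite !inE; apply: PL.
Qed.

Lemma prime_idealP (P : set R) :
  is_prime_ideal P <->
  [/\ is_ideal P, ~ P 1 & forall u v, P (u * v) -> P u \/ P v].
Proof.
split=> [[/proper_idealP[sP P1] Pp]|[sP P1 Pp]].
  split=> // u v Puv; have /orP[|] : (u \in P) || (v \in P).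
  - by apply: Pp; rewrite inE.
  - by rewrite inE; left.
  - by rewrite inE; right.
split; first exact/proper_idealP.
move=> u v; rewrite inE => /Pp[|] H; apply/orP;
  by [left; rewrite inE|right; rewrite inE].
Qed.

(** A colon ideal (N : x) that is maximal among those contained in q is prime:
    if a b x is in N but a x is not, then either (N : a x), which contains b, is
    contained in q, or it contains some s outside q, and then (N : s x), which
    contains a, is contained in q since q is prime. Both contain (N : x), hence
    are equal to it: then b x is in N, or a x is, against the assumption. *)
Lemma exists_prime_colon (V : lmodType R) (N : set V) (q : set R) (x : V) :
    is_submodule N -> is_prime_ideal q -> colon N x `<=` q ->
  exists2 y, is_prime_ideal (colon N y) & colon N y `<=` q.
Proof.
move=> sN /prime_idealP[sq q1 qp].
have sC y := @colon_ideal R V N y sN.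
suff H : forall J : set R^o, is_submodule J -> forall x, colon N x = J ->
    J `<=` q -> exists2 y, is_prime_ideal (colon N y) & colon N y `<=` q.
  by move=> Nxq; apply: (H _ (sC x) x).
apply: (@noetherian_ind R R^o _ Rnoeth) => J sJ IH y NyJ Jq.
have mono b z : colon N z `<=` colon N (b *: z).
  move=> a Na; rewrite /colon /preimage /= /smul scalerA mulrC -scalerA.
  exact: submoduleZ.
apply: contrapT => nex.
(* By the induction hypothesis, no colon ideal inside q is strictly above
   (N : y). *)
have stop z : colon N y `<=` colon N z -> colon N z `<=` q ->
    colon N z `<=` colon N y.
  move=> yz zq; apply: contrapT => nzy; apply: nex.
  by apply: (IH (colon N z) (sC z)) zq => //; rewrite -NyJ.
apply: (nex); exists y; last by rewrite NyJ.
apply/prime_idealP; split=> [||a b Nab]; first exact: sC.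
  by rewrite NyJ => /Jq.
have [|nNa] := pselect (colon N y a); [by left|right].
have colonZ c d z : colon N (c *: z) d = colon N z (c * d).
  by rewrite /colon /preimage /= /smul scalerA mulrC.
have [aq|/existsNP[s /not_implyP[Ns nqs]]] := pselect (colon N (a *: y) `<=` q).
  by apply: (stop _ (@mono a y) aq); rewrite colonZ.
case: nNa; apply: (stop _ (@mono s y)) => [r|].
  rewrite colonZ NyJ => /Jq /qp[]//.
by rewrite colonZ mulrC -colonZ.
Qed.

Variables (m : set R) (m_local : local_ring m).

Lemma proper_sub_local (J : set R) : is_ideal J -> ~ J 1 -> J `<=` m.
Proof.
move: J; apply: (@noetherian_ind R R^o _ Rnoeth) => J sJ IH J1.
apply: contrapT => nJm.
have Jmax : is_maximal_ideal J.
  split=> [|J' /proper_idealP[sJ' J'1] JJ']; first exact/proper_idealP.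
  apply/seteqP; split=> //; apply: contrapT => nJ'J.
  exact: nJm (subset_trans JJ' (IH J' sJ' (conj JJ' nJ'J) J'1)).
by apply: nJm; rewrite (m_local.2 _ Jmax).
Qed.

Lemma local_prime : is_prime_ideal m.
Proof.
have [[/proper_idealP[sm m1] mmax] _] := m_local.
apply/prime_idealP; split=> // a b mab.
have [|nma] := pselect (m a); [by left|right].
have sma := submodule_sumP (sm : is_submodule (m : set R^o))
  (submodule_image (smul (a : R^o)) (submodule_setT R^o)).
have [[u mu [_ [c _ <-] uE]]|nm1] :=
    pselect (submodule_sum (m : set R^o) (range (smul (a : R^o))) 1).
  rewrite -[b]mul1r -[1]uE mulrDl; apply: (@submoduleD R R^o) => //.
    by rewrite mulrC; apply: submoduleM.
  by rewrite /smul /= -mulrA; apply: submoduleM.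
case: nma; apply: (proper_sub_local sma nm1).
apply: sub_submodule_sumr => //; exists 1 => //; exact: scale1r.
Qed.

Hypothesis dimR : krull_dim_le R 1.

(** Otherwise q < p < m would be a chain of length 2. *)
Lemma nonmaximal_prime_minimal (p q : set R) :
  is_prime_ideal p -> p <> m -> is_prime_ideal q -> q `<=` p -> q = p.
Proof.
move=> pp pm qp qsp; apply/seteqP; split=> //; apply: contrapT => npq.
have [sp p1 _] := (prime_idealP p).1 pp.
have psm := proper_sub_local sp p1.
have nmp : ~ m `<=` p by move=> mp; apply: pm; apply/seteqP.
suff /dimR : prime_chain (fun i : 'I_3 => nth m [:: q; p; m] i) by [].
split=> [[[|[|[|]]]]//|]; first by move=> ?; apply: local_prime.
move=> [[|[|[|i]]] ?] [[|[|[|j]]] ?] //= _.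
by split=> [|mq]; [apply: subset_trans psm|apply: nmp; apply: subset_trans qsp].
Qed.

(** A minimal prime p is associated to R: the annihilator of 1 is contained in p,
    so some prime annihilator is, and it is p by minimality. *)
Lemma nonmaximal_prime_annihilator (p : set R) :
  is_prime_ideal p -> p <> m -> exists z : R^o, p = colon [set 0] z.
Proof.
move=> pp pm; have [sp _ _] := (prime_idealP p).1 pp.
have [|z zp zsp] := @exists_prime_colon R^o [set 0] p 1 (submodule_set1 R^o) pp.
  move=> a; rewrite /colon /preimage /= /smul /GRing.scale /= mulr1 => ->.
  exact: (@submodule0 R R^o).
by exists z; rewrite (nonmaximal_prime_minimal pp pm zp zsp).
Qed.

End Primes.

(** * Submodules of a tensor product with a flat module *)

Section SubmoduleType.
Variables (R : comNzRingType) (V : lmodType R) (N : set V).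

(** The predicate and the type take the proof sN as an argument because the
    instances below need it to hold. *)
Definition submodule_pred (sN : is_submodule N) : {pred V} := [in N].

Fact submodule_pred_closed (sN : is_submodule N) :
  submod_closed (submodule_pred sN).
Proof. exact: sN. Qed.

HB.instance Definition _ (sN : is_submodule N) :=
  GRing.isSubmodClosed.Build R V (submodule_pred sN) (submodule_pred_closed sN).

Record submodule_type (sN : is_submodule N) :=
  SubmoduleElt {submodule_val : V; _ : submodule_val \in submodule_pred sN}.

HB.instance Definition _ sN := [isSub for @submodule_val sN].
HB.instance Definition _ sN := [Choice of submodule_type sN by <:].
HB.instance Definition _ sN :=
  [SubChoice_isSubLmodule of submodule_type sN by <:].

Lemma submodule_range :
  is_submodule N -> exists (A : lmodType R) (f : {linear A -> V}), range f = N.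
Proof.
move=> sN; exists (submodule_type sN), (val : {linear submodule_type sN -> V}).
apply/seteqP; split=> [_ [[v Nv] _ <-]|v Nv] /=; first exact: set_mem Nv.
by exists (@SubmoduleElt sN v (mem_set Nv)).
Qed.

End SubmoduleType.

Section TensorSubmodules.
Variables (R : comNzRingType) (M : lmodType R).
Implicit Types A V W : lmodType R.

Local Notation tmap f := (tensor_map f (idfun : {linear M -> M})).

(** The image N M of N (x) M in V (x) M. *)
Definition tensor_sub V (N : set V) : set (tensor V M) :=
  submod_span [set tens v y | v in N & y in [set: M]].

Lemma tensor_subP V (N : set V) : is_submodule (tensor_sub N).
Proof. exact: submod_span_submodule. Qed.

Lemma tens_tensor_sub V (N : set V) v y : N v -> tensor_sub N (tens v y).
Proof. by move=> Nv; apply: sub_submod_span; exists v => //; exists y. Qed.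

Lemma tensor_sub_least V (N : set V) (T : set (tensor V M)) :
  is_submodule T -> (forall v y, N v -> T (tens v y)) -> tensor_sub N `<=` T.
Proof.
by move=> sT NT; apply: submod_span_sub => // _ [v Nv [y _ <-]]; apply: NT.
Qed.

Lemma tensor_sub_mono V (N N' : set V) :
  N `<=` N' -> tensor_sub N `<=` tensor_sub N'.
Proof.
move=> NN'; apply: tensor_sub_least => [|v y /NN']; first exact: tensor_subP.
exact: tens_tensor_sub.
Qed.

Lemma tensor_sub_setT V (t : tensor V M) : tensor_sub [set: V] t.
Proof.
have sT := tensor_subP [set: V].
have [z ->] := tensor_pi_surj t; rewrite -(freeg_sumE z) linear_sum.
elim/big_rec: _ => [|[v y] u _ Tu]; first exact: submodule0 sT.
apply: (submoduleD sT) Tu.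
have -> : << coeff (v, y) z *g (v, y) >> =
    coeff (v, y) z *: << (v, y) >> :> {freeg (V * M)%type / R}.
  by apply/eqP/freeg_eqP => k; rewrite coeffZ !coeffU mul1r.
by rewrite linearZ; apply: (submoduleZ _ sT); apply: tens_tensor_sub.
Qed.

Lemma tensor_map_sub V W (f : {linear V -> W}) (N : set V) t :
  tensor_sub N t -> tensor_sub (f @` N) (tmap f t).
Proof.
apply: (tensor_sub_least (submodule_preimage (tmap f) (tensor_subP _))).
move=> v y Nv; rewrite /preimage /= tensor_map_tens.
by apply: tens_tensor_sub; exists v.
Qed.

Lemma tensor_sub_range A V (f : {linear A -> V}) t :
  tensor_sub (range f) t -> exists s, t = tmap f s.
Proof.
move=> ft; suff [s _ <-] : range (tmap f) t by exists s.
apply: tensor_sub_least ft.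
  exact: submodule_image (submodule_setT (tensor A M)).
by move=> _ y [v _ <-]; exists (tens v y) => //; rewrite tensor_map_tens.
Qed.

Lemma tensor_map_comp A V W (f : {linear A -> V}) (g : {linear V -> W})
    (h : {linear A -> W}) t :
  (forall a, g (f a) = h a) -> tmap g (tmap f t) = tmap h t.
Proof.
move=> gf; apply: (tensor_ext (g := tmap g \o tmap f)) => a b /=.
by rewrite !tensor_map_tens gf.
Qed.

Hypothesis M_flat : flat M.

(** Exactness at V of the tensored sequence ker g -> V -> W. *)
Lemma flat_kernel V W (g : {linear V -> W}) t :
  tmap g t = 0 -> tensor_sub (g @^-1` [set 0]) t.
Proof.
have [A [f fE]] := submodule_range (submodule_preimage g (submodule_set1 W)).
have : exact f g by rewrite /exact fE.
move=> /M_flat fg gt0; have [s _ <-] : range (tmap f) t by rewrite fg.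
by rewrite -fE; apply: tensor_map_sub; apply: tensor_sub_setT.
Qed.

(** Tensoring with a flat module commutes with preimages of submodules, since
    the preimage of N under f is the projection to A of the kernel of
    (a, b) |-> f a + b on A * N. *)
Lemma flat_preimage A V (f : {linear A -> V}) (N : set V) s :
  is_submodule N -> tensor_sub N (tmap f s) -> tensor_sub (f @^-1` N) s.
Proof.
move=> sN; have [B [g gN]] := submodule_range sN.
rewrite -[in X in X -> _]gN => /tensor_sub_range[u fsE].
(* The second component of e has the opposite sign, so that h e = 0. *)
pose h (ab : A * B) : V := f ab.1 + g ab.2.
have h_lin : linear h.
  by move=> c x y; rewrite /h /= !linearP /= scalerDr addrACA.
pose hL : {linear (A * B)%type -> V} :=
  HB.pack h (GRing.isLinear.Build R _ _ _ h h_lin).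
pose i1 (a : A) : (A * B)%type := (a, 0).
have i1_lin : linear i1 by move=> c x y; congr (_, _); rewrite /= scaler0 addr0.
pose i1L : {linear A -> (A * B)%type} :=
  HB.pack i1 (GRing.isLinear.Build R _ _ _ i1 i1_lin).
pose i2 (b : B) : (A * B)%type := (0, b).
have i2_lin : linear i2 by move=> c x y; congr (_, _); rewrite /= scaler0 addr0.
pose i2L : {linear B -> (A * B)%type} :=
  HB.pack i2 (GRing.isLinear.Build R _ _ _ i2 i2_lin).
pose p1 (ab : A * B) : A := ab.1.
have p1_lin : linear p1 by [].
pose p1L : {linear (A * B)%type -> A} :=
  HB.pack p1 (GRing.isLinear.Build R _ _ _ p1 p1_lin).
pose e := tmap i1L s - tmap i2L u.
have he : tmap hL e = 0.
  rewrite linearB /= (@tensor_map_comp _ _ _ i1L hL f); last first.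
    by move=> a; rewrite /= /h /= linear0 addr0.
  rewrite (@tensor_map_comp _ _ _ i2L hL g) -?fsE ?subrr //.
  by move=> b; rewrite /= /h /= linear0 add0r.
have p1e : tmap p1L e = s.
  rewrite linearB /= (@tensor_map_comp _ _ _ i1L p1L idfun) //.
  rewrite (@tensor_map_comp _ _ _ i2L p1L \0) //.
  rewrite (tensor_ext (g := tmap idfun) (h := idfun)); last first.
    by move=> a b; rewrite /= tensor_map_tens.
  rewrite (tensor_ext (g := tmap \0) (h := \0)) ?subr0 // => a b.
  by rewrite /= tensor_map_tens /= linear0l.
have := tensor_map_sub (f := p1L) (flat_kernel he); rewrite p1e.
apply: tensor_sub_mono.
move=> _ [[a b] /= hab <-]; rewrite /preimage /= /p1 /=.
have -> : f a = g (- b).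
  by rewrite linearN; apply/eqP; rewrite -addr_eq0; apply/eqP.
by rewrite -gN; exists (- b).
Qed.

End TensorSubmodules.

(** * Separation *)

Section UnitTensor.
Variables (R : comNzRingType) (M : lmodType R).

Definition scale_pair (a : R^o) (y : M) : M := a *: y.

Lemma scale_pair_bilinear : bilinear_for *:%R *:%R scale_pair.
Proof.
split=> [y c a1 a2|a c y1 y2]; rewrite /scale_pair /=.
  by rewrite scalerDl scalerA.
by rewrite scalerDr !scalerA mulrC.
Qed.

HB.instance Definition _ := bilinear_isBilinear.Build R R^o M M *:%R *:%R
  scale_pair scale_pair_bilinear.

(** The isomorphism of R (x) M with M. *)
Definition unit_tensor : {linear tensor R^o M -> M} := tensor_lift scale_pair.

Lemma unit_tensor_tens (a : R^o) (y : M) : unit_tensor (tens a y) = a *: y.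
Proof. exact: tensor_lift_tens. Qed.

End UnitTensor.

Section Separation.
Variables (R : comNzRingType) (m : set R) (M : lmodType R).
Hypotheses (R_noetherian : noetherian R) (R_local : local_ring m).
Hypotheses (dimR : krull_dim_le R 1).
Hypotheses (M_separated : separated m M) (M_flat : flat M).

Lemma tens_smul (X : lmodType R) (x : X) (y : M) :
  tensor_map (smul x) (idfun : {linear M -> M}) (tens (1 : R^o) y) = tens x y.
Proof. by rewrite tensor_map_tens /= /smul scale1r. Qed.

Section Cyclic.
Variables (X : lmodType R) (x : X).
Implicit Types N : set X.

Lemma tensor_sub_colon N (y : M) :
  is_submodule N ->
  tensor_sub N (tens x y) -> tensor_sub (colon N x : set R^o) (tens (1 : R^o) y).
Proof. by move=> sN; rewrite -tens_smul; apply: flat_preimage. Qed.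

Lemma colon_tensor_sub N (y : M) :
  tensor_sub (colon N x : set R^o) (tens (1 : R^o) y) -> tensor_sub N (tens x y).
Proof.
move=> /(tensor_map_sub (f := smul x)); rewrite tens_smul.
by apply: tensor_sub_mono; apply: image_preimage_subset.
Qed.

Lemma tensor_sub_adjoin N (t : tensor X M) :
  is_submodule N ->
  tensor_sub (submodule_sum N (range (smul x))) t ->
  exists y, tensor_sub N (t - tens x y : tensor X M).
Proof.
move=> sN; have sT := tensor_subP M N.
move: t; apply: tensor_sub_least => [|_ w [u Nu [_ [a _ <-] <-]]].
  apply/submoduleP; split=> [|c t1 t2 [y1 t1P] [y2 t2P]].
    by exists 0; rewrite linear0r subr0; apply: submodule0 sT.
  exists (c *: y1 + y2); rewrite linearPr opprD addrACA -scalerBr.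
  exact: (submoduleD sT (submoduleZ _ sT t1P) t2P).
exists (a *: w); rewrite linearDl linearZr_LR linearZl_LR addrK.
exact: tens_tensor_sub.
Qed.

Let scaled N k : set X := submodule_sum N (smul x @` (ideal_pow m k : set R^o)).

(** If p = (N : x) is m, the case k = 1 suffices. Otherwise p = Ann z; a
    coefficient in (N + m^k x : x) = m^k + p is taken into z m^k by z, so z y is
    in m^k M for all k, and is 0. Then y is in p M by flatness. *)
Lemma tensor_sub_scaled N (y : M) :
  is_submodule N ->
  is_prime_ideal (colon N x) ->
  (forall k, tensor_sub (scaled N k) (tens x y)) -> tensor_sub N (tens x y).
Proof.
move=> sN pP yP; have [pm|pm] := pselect (colon N x = m).
  apply: tensor_sub_mono (yP 1%N) => _ [u Nu [_ [a ma <-] <-]].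
  apply: (submoduleD sN Nu); suff mN : ideal_pow m 1 `<=` colon N x by apply: mN.
  apply: (ideal_pow_sub (colon_ideal x sN)) => b c mb _.
  by rewrite mulrC; apply: submoduleM (colon_ideal x sN) _; rewrite pm.
have [z zP] := nonmaximal_prime_annihilator R_noetherian R_local dimR pP pm.
have zy0 : (z : R) *: y = 0.
  suff : (\bigcap_(n in [set n | (1 <= n)%N])
      ideal_smul (ideal_pow m n) [set: M]) ((z : R) *: y) by rewrite M_separated.
  move=> k _; set I := ideal_smul _ _.
  have sI : is_submodule I by apply: submod_span_submodule.
  have sk : is_submodule (scaled N k).
    exact: submodule_sumP sN (submodule_image _ (ideal_powP m k)).
  rewrite -[y]scale1r -(unit_tensor_tens (1 : R^o)).
  have sI' := submodule_preimage (unit_tensor M)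
    (submodule_preimage ( *:%R (z : R) : {linear M -> M}) sI).
  have := tensor_sub_colon sk (yP k).
  move: (tens _ _); apply: (tensor_sub_least sI').
  move=> r w [u Nu [_ [a ma <-] raE]].
  rewrite /preimage /= unit_tensor_tens scalerA.
  have pra : colon N x (r - a : R^o).
    by rewrite /colon /preimage /= linearB /= -raE addrK.
  have -> : ((z : R) * (r : R)) *: w = (a : R) *: ((z : R) *: w).
    rewrite scalerA mulrC; congr (_ *: _); apply: subr0_eq.
    by move: pra; rewrite zP -mulrBl.
  by apply: sub_submod_span; exists a => //; exists ((z : R) *: w).
apply: colon_tensor_sub; rewrite zP; apply: flat_kernel => //.
rewrite tens_smul -[z]mulr1 (linearZl_LR (tens (B := M))) -linearZr_LR.
by rewrite zy0 linear0r.
Qed.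

End Cyclic.

(** The induction step passes from N to N + R x with (N : x) prime. *)
Lemma tensor_sub_closed (X : lmodType R) (N : set X) :
    fin_gen X -> is_submodule N ->
  forall t : tensor X M,
  (forall n, tensor_sub
    (submodule_sum (ideal_smul (ideal_pow m n) [set: X]) N) t) ->
  tensor_sub N t.
Proof.
move=> Xfg; have Xnoeth := fin_gen_noetherian R_noetherian Xfg.
move: N; apply: (noetherian_ind Xnoeth) => N sN IH t tP.
have [NT|/existsNP[x0 nNx0]] := pselect (forall x, N x).
  by apply: tensor_sub_mono (tensor_sub_setT t) => x _.
have mP := local_prime R_noetherian R_local.
have [|x xP xm] := exists_prime_colon R_noetherian sN mP (x := x0).
  apply: (proper_sub_local R_noetherian R_local); first exact: colon_ideal.
  by rewrite /colon /preimage /= /smul scale1r.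
have nNx : ~ N x.
  by case/prime_idealP: xP => _ + _; rewrite /colon /preimage /= /smul scale1r.
pose N' := submodule_sum N (range (smul x)).
have sRx := submodule_image (smul x) (submodule_setT R^o).
have sN' : is_submodule N' := submodule_sumP sN sRx.
have NN' : N `<=` N' := sub_submodule_suml sRx.
have N'x : N' x by apply: (sub_submodule_sumr sN); exists 1 => //; apply: scale1r.
have sI n := submod_span_submodule
  [set a *: v | a in ideal_pow m n & v in [set: X]].
have N't : tensor_sub N' t.
  apply: (IH _ sN') => [|n]; first by split=> // /(_ x N'x).
  apply: tensor_sub_mono (tP n) => _ [u mu [v /NN' N'v <-]].
  by exists u => //; exists v.
have [y ty] := tensor_sub_adjoin sN N't.
rewrite -[t](subrK (tens x y)); apply: (submoduleD (tensor_subP M N) ty).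
apply: tensor_sub_scaled => // k.
set Q := submodule_sum N _.
have sk := submodule_image (smul x) (ideal_powP m k).
have sQ : is_submodule Q := submodule_sumP sN sk.
have NQ : N `<=` Q := sub_submodule_suml sk.
have [|n nP] := artin_rees Xnoeth sN' sQ (m := m).
  move=> a _ ma [u Nu [_ [r _ <-] <-]]; exists k; rewrite scalerDr.
  apply: (submoduleD sQ); first by apply: NQ; apply: submoduleZ.
  apply: (sub_submodule_sumr sN); exists (a ^+ k * r);
    last by rewrite /smul scalerA.
  by rewrite mulrC; apply: submoduleM (ideal_powP m k) (ideal_pow_exp k ma).
(* By flatness t is in ((m^n X + N) `&` N') M, and that submodule is in Q. *)
have Qt : tensor_sub Q t.
  have [A [f fN']] := submodule_range sN'.
  move: (N't); rewrite -[N' in tensor_sub N' _]fN' => /tensor_sub_range[s tE].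
  have := tP n; rewrite tE => /(flat_preimage M_flat (submodule_sumP (sI n) sN)).
  move=> /(tensor_map_sub (f := f)); apply: tensor_sub_mono.
  move=> _ [a [u mu [v Nv uvE]] <-].
  have N'fa : N' (f a) by rewrite -fN'; exists a.
  rewrite -uvE; apply: (submoduleD sQ); last exact: NQ.
  apply: nP; split=> //; rewrite -[u](addrK v) uvE.
  exact: (submoduleB sN' N'fa (NN' _ Nv)).
rewrite -[tens x y](subKr t).
exact: submoduleB (tensor_subP M Q) Qt (tensor_sub_mono NQ ty).
Qed.

End Separation.

Theorem mainTheorem10 (R : comNzRingType) (m : set R)
    (R_noetherian : noetherian R) (R_local : local_ring m)
    (dimR : krull_dim_le R 1) (M : lmodType R)
    (M_separated : separated m M) (M_flat : flat M) :
  totally_separated m M.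
Proof.
move=> X Xfg; apply/seteqP; split=> [t tP|_ -> n _]; last first.
  exact: submodule0 (submod_span_submodule _).
suff : tensor_sub [set 0] t.
  apply: (tensor_sub_least (submodule_set1 (tensor X M))) => _ y ->.
  by rewrite /set1 /mkset linear0l.
apply: (tensor_sub_closed R_noetherian R_local dimR M_separated M_flat) => //.
  exact: submodule_set1.
move=> n; have sI := submod_span_submodule
  [set a *: v | a in ideal_pow m n & v in [set: X]].
apply: tensor_sub_mono (sub_submodule_suml (submodule_set1 X)) _ _.
have [->|n0] := posnP n.
  apply: tensor_sub_mono (tensor_sub_setT t) => x _; rewrite -[x]scale1r.
  by apply: sub_submod_span; exists 1 => //; exists x.
have sT := tensor_subP M (ideal_smul (ideal_pow m n) [set: X]).
apply: (submod_span_sub sT) (tP n n0) => _ [a ma [u _ <-]].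
have sa := submodule_preimage ( *:%R a : {linear tensor X M -> tensor X M}) sT.
apply: (tensor_sub_least sa) (tensor_sub_setT u) => x y _.
rewrite /preimage /= -linearZl_LR; apply: tens_tensor_sub.
by apply: sub_submod_span; exists a => //; exists x.
Qed.
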